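(* Let $\delta\in[0,\infty)$ and let $X$ and $Y$ be extended metric spaces with the same underlying set such that $d_X\le d_Y+\delta$ and $d_Y\le d_X+\delta$ pointwise (inequalities in $[0,\infty]$). Then, for every $n\ge 0$, $PH_n(X)$ and $PH_n(Y)$ are $(n+1)\delta$-interleaved, so $$d_I\bigl(PH_n(X),PH_n(Y)\bigr)\le(n+1)\delta.$$
   Context: An extended metric space $X$ is a set $\mathrm{Ob}\,X$ with $d_X\colon \mathrm{Ob}\,X\times \mathrm{Ob}\,X\to[0,\infty]$ such that $d_X(x,x)=0$, $d_X(x,y)=d_X(y,x)$, the triangle inequality holds, and $d_X(x,y)=0$ implies $x=y$. The length nerve $N(X)$ is the simplicial set with $N(X)_n$ the set of all maps $[n]\to\mathrm{Ob}\,X$, written $\mathbf{x}=\langle x_0,\dots,x_n\rangle$; the face $d_i$ deletes the entry $x_i$ and the degeneracy $s_i$ repeats it. The length is $\lambda\mathbf{x}=\sum_{i=1}^n d_X(x_{i-1},x_i)\in[0,\infty]$. The normalised chain complex $C_\bullet(X)$ has $C_n(X)=\mathbb{Z}[N(X)_n]/D_n(X)$, with $D_n(X)$ spanned by the degenerate simplices and differential $\partial=\sum_{i=0}^n(-1)^i d_i$; $C_n(X)$ is free on the nondegenerate tuples ($x_{i-1}\ne x_i$ for all $i$). For $\ell\in[0,\infty)$, $F_\ell C_n(X)\subseteq C_n(X)$ is spanned by the nondegenerate tuples with $\lambda\mathbf{x}\le\ell$; these form subcomplexes increasing in $\ell$. Persistent magnitude homology is the functor $PH_n(X)\colon([0,\infty),\le)\to\mathsf{Ab}$,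 $\ell\mapsto H_n(F_\ell C_\bullet(X))$, with transition maps induced by inclusions. For functors $M,N\colon([0,\infty),\le)\to\mathcal{A}$ into an abelian category and $\epsilon\in[0,\infty)$, an $\epsilon$-interleaving of $M$ and $N$ is a pair of families $\varphi_\ell\colon M\ell\to N(\ell+\epsilon)$ and $\psi_\ell\colon N\ell\to M(\ell+\epsilon)$, natural in $\ell$, with $\psi_{\ell+\epsilon}\varphi_\ell=M(\ell\le\ell+2\epsilon)$ and $\varphi_{\ell+\epsilon}\psi_\ell=N(\ell\le\ell+2\epsilon)$ for all $\ell$. The interleaving distance is $d_I(M,N)=\inf\{\epsilon\mid M\text{ and }N\text{ are }\epsilon\text{-interleaved}\}$, with $\inf\varnothing=\infty$. *)

(* Defs.v *)
From HB Require Import structures.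
From mathcomp Require Import all_boot all_order all_algebra.
From mathcomp Require Import freeg.
From mathcomp Require Import all_classical all_reals ereal.
From mathcomp Require Import zify.

Set Implicit Arguments.
Unset Strict Implicit.
Unset Printing Implicit Defensive.

Import Order.TTheory GRing.Theory Num.Theory.

Local Open Scope classical_set_scope.
Local Open Scope quotient_scope.
Local Open Scope ring_scope.

Section Zspan.
Context (V : zmodType).
Implicit Types (A : set V) (S : zmodClosed V).

Definition zspan A : {pred V} := fun v =>
  `[< exists s : seq (int * V),
        (forall p, p \in s -> A p.2) /\ v = \sum_(p <- s) p.2 *~ p.1 >].

Lemma zspan_zmod_closed A : zmod_closed (zspan A).
Proof.
split=> [|u v /asboolP[s [sA ->]] /asboolP[t [tA ->]]].
  by apply/asboolP; exists [::]; rewrite big_nil.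
apply/asboolP; exists (s ++ [seq (- p.1, p.2) | p <- t]); split.
  move=> p; rewrite mem_cat => /orP[/sA //|/mapP[q /tA Aq ->]]; exact: Aq.
rewrite big_cat big_map -sumrN; congr (_ + _).
by apply: eq_bigr => p _; rewrite mulrNz.
Qed.

HB.instance Definition _ A :=
  GRing.isZmodClosed.Build V (zspan A) (zspan_zmod_closed A).

Lemma mem_zspan A v : A v -> v \in zspan A.
Proof.
move=> Av; apply/asboolP; exists [:: (1, v)]; rewrite big_seq1 mulr1z.
by split=> // p; rewrite inE => /eqP ->.
Qed.

Lemma zspan_ind A (W : zmodType) (f : {additive V -> W}) (S : zmodClosed W) :
  (forall v, A v -> f v \in S) -> forall v, v \in zspan A -> f v \in S.
Proof.
move=> AS v /asboolP[s [sA ->]]; rewrite raddf_sum big_seq.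
by apply: rpred_sum => p /sA Ap; rewrite raddfMz rpredMz// AS.
Qed.

End Zspan.

Section Subgroup.
Context (V : zmodType) (S : zmodClosed V).

Record subgrp := Subgrp { sgval : V; sgvalP : sgval \in S }.

HB.instance Definition _ := [isSub for sgval].
HB.instance Definition _ := [Choice of subgrp by <:].
HB.instance Definition _ := [SubChoice_isSubZmodule of subgrp by <:].

End Subgroup.

Section SubgroupMap.
Context (V W : zmodType) (S : zmodClosed V) (S' : zmodClosed W).
Context (f : {additive V -> W}) (fS : forall v, v \in S -> f v \in S').

Definition sgmap (v : subgrp S) : subgrp S' := Subgrp (fS (sgvalP v)).

Lemma sgmap_is_zmod_morphism : zmod_morphism sgmap.
Proof. by move=> u v; apply: val_inj; rewrite /= raddfB. Qed.

HB.instance Definition _ :=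
  GRing.isZmodMorphism.Build _ _ sgmap sgmap_is_zmod_morphism.

End SubgroupMap.
Arguments sgmap {V W S S' f} fS v.

Section QuotientMap.
Context (V W : zmodType) (I : zmodClosed V) (J : zmodClosed W).
Context (f : {additive V -> W}).

(* The side condition [fI] is an argument of [qmap] so that the additivity of
   [qmap fI] can be found by unification. *)
Definition qmap (fI : forall v, v \in I -> f v \in J)
    (q : Quotient.quot I) : Quotient.quot J :=
  \pi_(Quotient.quot J) (f (repr q)).

Context (fI : forall v, v \in I -> f v \in J).

Lemma qmapE v :
  qmap fI (\pi_(Quotient.quot I) v) = \pi_(Quotient.quot J) (f v).
Proof.
apply/eqP; rewrite -Quotient.idealrBE -raddfB; apply: fI.
by rewrite Quotient.idealrBE reprK.
Qed.

Lemma qmap_is_zmod_morphism : zmod_morphism (qmap fI).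
Proof.
elim/quotW=> u; elim/quotW=> v.
by rewrite -raddfB !qmapE -raddfB/= raddfB.
Qed.

HB.instance Definition _ :=
  GRing.isZmodMorphism.Build _ _ (qmap fI) qmap_is_zmod_morphism.

End QuotientMap.

Record complex := Complex {
  chain :> nat -> zmodType;
  bd : forall n, {additive chain n.+1 -> chain n};
  bdbd : forall n (c : chain n.+2), bd n (bd n.+1 c) = 0 }.

Section Homology.
Context (C : complex).

(* The differential out of degree 0 is zero. *)
Definition cycle n : {pred C n} :=
  match n return {pred C n} with
  | 0 => fun _ => true
  | m.+1 => fun c => bd C m c == 0
  end.

Lemma cycle_zmod_closed n : zmod_closed (@cycle n).
Proof.
case: n => [|n]; split=> //= [|u v]; rewrite !unfold_in ?raddf0//=.
by rewrite raddfB => /eqP-> /eqP->; rewrite subr0.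
Qed.

HB.instance Definition _ n :=
  GRing.isZmodClosed.Build (C n) (@cycle n) (cycle_zmod_closed n).

Definition boundary n : {pred subgrp (@cycle n)} := fun z =>
  `[< exists b : C n.+1, sgval z = bd C n b >].

Lemma boundary_zmod_closed n : zmod_closed (@boundary n).
Proof.
split=> [|u v /asboolP[a ua] /asboolP[b vb]]; apply/asboolP.
  by exists 0; rewrite raddf0.
by exists (a - b); rewrite raddfB -ua -vb.
Qed.

HB.instance Definition _ n :=
  GRing.isZmodClosed.Build _ (@boundary n) (boundary_zmod_closed n).

Definition homology n : zmodType := Quotient.quot (@boundary n).

End Homology.

Record chainmap (C D : complex) := ChainMap {
  cmap :> forall n, {additive C n -> D n};
  cmap_bd : forall n (c : C n.+1), cmap n (bd C n c) = bd D n (cmap n.+1 c) }.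

Section HomologyMap.
Context (C D : complex) (f : chainmap C D).

Lemma cmap_cycle n (c : C n) : c \in @cycle C n -> f n c \in @cycle D n.
Proof.
case: n c => [|n] c //; rewrite !unfold_in /= => /eqP c0.
by rewrite -cmap_bd c0 raddf0.
Qed.

Definition cyclemap n :
    {additive subgrp (@cycle C n) -> subgrp (@cycle D n)} :=
  sgmap (@cmap_cycle n).

Lemma cmap_boundary n z : z \in @boundary C n -> cyclemap n z \in @boundary D n.
Proof.
move=> /asboolP[b zb]; apply/asboolP; exists (f n.+1 b).
by rewrite -cmap_bd -zb.
Qed.

Definition homology_map n : {additive homology C n -> homology D n} :=
  qmap (@cmap_boundary n).

Lemma homology_mapE n z :
  homology_map n (\pi_(homology C n) z) = \pi_(homology D n) (cyclemap n z).
Proof. exact: qmapE. Qed.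

End HomologyMap.

Section Subcomplex.
Context (C : complex) (S : forall n, zmodClosed (C n)).
Context (bdS : forall n c, c \in S n.+1 -> bd C n c \in S n).

Lemma subcomplex_bdbd n (c : subgrp (S n.+2)) :
  sgmap (@bdS n) (sgmap (@bdS n.+1) c) = 0.
Proof. by apply: val_inj; rewrite /= bdbd. Qed.

Definition subcomplex : complex :=
  @Complex (fun n => subgrp (S n)) (fun n => sgmap (@bdS n)) subcomplex_bdbd.

End Subcomplex.

Section SubcomplexInclusion.
Context (C : complex) (S S' : forall n, zmodClosed (C n)).
Context (bdS : forall n c, c \in S n.+1 -> bd C n c \in S n).
Context (bdS' : forall n c, c \in S' n.+1 -> bd C n c \in S' n).
Context (SS' : forall n c, c \in S n -> c \in S' n).

Lemma subcomplex_incl_bd n (c : subcomplex bdS n.+1) :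
  sgmap (f := idfun) (@SS' n) (bd (subcomplex bdS) n c) =
  bd (subcomplex bdS') n (sgmap (f := idfun) (@SS' n.+1) c).
Proof. exact: val_inj. Qed.

Definition subcomplex_incl :
    chainmap (subcomplex bdS) (subcomplex bdS') :=
  @ChainMap (subcomplex bdS) (subcomplex bdS')
    (fun n => sgmap (f := idfun) (@SS' n)) subcomplex_incl_bd.

End SubcomplexInclusion.

Section Nerve.
Context (T : choiceType).

Definition nerve n := {ffun 'I_n.+1 -> T}.

Definition face n (i : 'I_n.+2) (x : nerve n.+1) : nerve n :=
  [ffun j => x (fintype.lift i j)].

Definition degen n (i : 'I_n.+1) (x : nerve n) : nerve n.+1 :=
  [ffun j : 'I_n.+2 => x (inord (unbump i j))].

(* [degenerate] is membership in the image of some degeneracy; see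
   [degenerateP] for the equivalence with two consecutive equal entries. *)
Definition degenerate n : set (nerve n) :=
  match n return set (nerve n) with
  | 0 => set0
  | m.+1 => [set x | exists i y, x = degen i y]
  end.

Definition nondegenerate n (x : nerve n) : bool :=
  [forall i : 'I_n, x (widen_ord (leqnSn n) i) != x (fintype.lift ord0 i)].

Lemma degenerateP n (x : nerve n) : degenerate x <-> ~~ nondegenerate x.
Proof.
case: n x => [|n] x /=.
  by split=> // /forallPn[[]].
split=> [[i [y ->]]|/forallPn[i]].
  apply/forallPn; exists i; rewrite negbK !ffunE; apply/eqP; congr (y _).
  apply: val_inj; rewrite /= !inordK /unbump /= ?/bump /=; have := ltn_ord i; lia.
rewrite negbK => /eqP xi; exists i, (face (fintype.lift ord0 i) x).
apply/ffunP => j; rewrite !ffunE; have := ltn_ord i; have := ltn_ord j => ltj lti.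
case: (eqVneq (j : nat) i.+1) => ji.
  transitivity (x (fintype.lift ord0 i)); first by congr (x _); exact: val_inj.
  rewrite -xi; congr (x _); apply: val_inj.
  by rewrite /= inordK /unbump /bump /=; lia.
congr (x _); apply: val_inj.
by rewrite /= inordK /unbump /bump /=; lia.
Qed.

Lemma face_face n (i : 'I_n.+3) (j : 'I_n.+2) (i' : 'I_n.+3) (j' : 'I_n.+2)
    (x : nerve n.+2) :
  i' = bump i j :> nat -> j' = unbump j i :> nat ->
  face j (face i x) = face j' (face i' x).
Proof.
move=> ii' jj'; apply/ffunP => k; rewrite !ffunE; congr (x _); apply: val_inj.
by rewrite /= ii' jj' /unbump /bump; lia.
Qed.

End Nerve.

Section FreeAbelian.
Context (K : choiceType) (W : zmodType) (S : zmodClosed W).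
Context (f : {additive {freeg K / int} -> W}).

Lemma freeg_mem : (forall x, f << x >> \in S) -> forall c, f c \in S.
Proof.
move=> fS c; rewrite -[c]freeg_sumE raddf_sum; apply: rpred_sum => x _.
by rewrite -[coeff x c]intz -freegU_mulz raddfMz rpredMz.
Qed.

Lemma freeg_sign_mem i c : f c \in S -> f ((-1) ^+ i *: c) \in S.
Proof. by rewrite -signr_odd scaler_sign; case: odd; rewrite ?raddfN ?rpredN. Qed.

End FreeAbelian.

Section NormalisedComplex.
Context (T : choiceType).
Implicit Types n : nat.

Definition freechain n : zmodType := {freeg (nerve T n) / int}.

Definition simplex_bd n (x : nerve T n.+1) : {freeg (nerve T n) / int} :=
  \sum_(i < n.+2) (-1) ^+ i *: << face i x >>.

Definition free_bd n : freechain n.+1 -> freechain n := fglift (@simplex_bd n).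

Lemma free_bd_is_zmod_morphism n : zmod_morphism (@free_bd n).
Proof. exact: lift_is_additive. Qed.

HB.instance Definition _ n :=
  GRing.isZmodMorphism.Build _ _ (@free_bd n) (@free_bd_is_zmod_morphism n).

Lemma free_bdU n x : free_bd << x >> = @simplex_bd n x.
Proof. by rewrite /free_bd liftU scale1r. Qed.

Lemma free_bd_sign n i (c : {freeg (nerve T n.+1) / int}) :
  free_bd ((-1) ^+ i *: c) =
  (-1) ^+ i *: (free_bd c : {freeg (nerve T n) / int}).
Proof. by rewrite -signr_odd !scaler_sign; case: odd; rewrite ?raddfN. Qed.

Lemma free_bd_bdU n (x : nerve T n.+2) : free_bd (simplex_bd x) = 0.
Proof.
pose F (p : 'I_n.+3 * 'I_n.+2) : {freeg (nerve T n) / int} :=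
  (-1) ^+ (p.1 + p.2)%N *: << face p.2 (face p.1 x) >>.
have -> : free_bd (simplex_bd x) = \sum_p F p.
  rewrite raddf_sum -(pair_bigA _ (fun i j => F (i, j))) /=.
  apply: eq_bigr => i _; rewrite free_bd_sign free_bdU scaler_sumr.
  by apply: eq_bigr => j _; rewrite /F /= exprD scalerA.
pose h (p : 'I_n.+3 * 'I_n.+2) : 'I_n.+3 * 'I_n.+2 :=
  (inord (bump p.1 p.2), inord (unbump p.2 p.1)).
have h1 p : (h p).1 = bump p.1 p.2 :> nat.
  by rewrite /= inordK // /bump; have := ltn_ord p.2; lia.
have h2 p : (h p).2 = unbump p.2 p.1 :> nat.
  rewrite /= inordK // /unbump.
  by have := ltn_ord p.1; have := ltn_ord p.2; lia.
have hK : involutive h.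
  move=> p; apply: injective_projections; apply: ord_inj.
    by rewrite !(h1, h2) /unbump /bump; lia.
  by rewrite !(h1, h2) /unbump /bump; lia.
have Fh p : F (h p) = - F p.
  rewrite /F -(face_face x (h1 p) (h2 p)) -scaleNr; congr (_ *: _).
  rewrite h1 h2 -[RHS]mulN1r -exprS -[LHS]signr_odd -[RHS]signr_odd; congr (_ ^+ _).
  by congr nat_of_bool; rewrite /unbump /bump; lia.
rewrite (bigID (fun p : 'I_n.+3 * 'I_n.+2 => (p.2 < p.1)%N)) /=.
rewrite [X in X + _](reindex_inj (inv_inj hK)) /=.
rewrite [X in X + _](eq_bigl (fun p : 'I_n.+3 * 'I_n.+2 => ~~ (p.2 < p.1)%N)).
  by rewrite -big_split big1 //= => p _; rewrite Fh addNr.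
by move=> p; rewrite -/(h p).1 -/(h p).2 h1 h2 /unbump /bump; lia.
Qed.

Lemma free_bd_bd n (c : freechain n.+2) : free_bd (free_bd c) = 0.
Proof.
have : (@free_bd n \o @free_bd n.+1) c \in zspan (set0 : set (freechain n)).
  apply: freeg_mem => x.
  have bd0 : free_bd (free_bd << x >>) = 0 by rewrite free_bdU free_bd_bdU.
  by rewrite [X in X \in _]bd0 rpred0.
move=> /asboolP[s [s0 /= ->]]; rewrite big_seq big1 // => p /s0 [].
Qed.

Definition degenerate_chain n : {pred freechain n} :=
  zspan [set << x >> | x in @degenerate T n].

HB.instance Definition _ n := GRing.ZmodClosed.on (@degenerate_chain n).

Lemma free_bd_degenerate n c :
  c \in @degenerate_chain n.+1 -> free_bd c \in @degenerate_chain n.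
Proof.
apply: zspan_ind => _ [x /degenerateP/forallPn[k]] + <-.
rewrite negbK => /eqP xk; rewrite /= free_bdU /simplex_bd.
set a := widen_ord _ _ in xk; set b := fintype.lift _ _ in xk.
have [aE bE] : a = k :> nat /\ b = k.+1 :> nat by [].
have ltk := ltn_ord k.
have ab : b != a.
  by apply/eqP => /(congr1 (@nat_of_ord _)); rewrite aE bE; lia.
rewrite (bigD1 a) //= (bigD1 b) //= addrA.
have -> : face b x = face a x.
  apply/ffunP => j; rewrite !ffunE.
  case: (eqVneq (j : nat) k) => jk.
    transitivity (x a); first by congr (x _); apply: val_inj; rewrite /= /bump; lia.
    by rewrite xk; congr (x _); apply: val_inj; rewrite /= /bump; lia.
  by congr (x _); apply: val_inj; rewrite /= /bump; lia.
rewrite exprS mulN1r scaleNr subrr add0r; apply: rpred_sum => i /andP[ia ib].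
apply: (@freeg_sign_mem _ _ _ idfun); apply: mem_zspan; exists (face i x) => //.
apply/degenerateP/forallPn.
have {ia}ik : i != k :> nat by apply: contraNneq ia => ik; exact/eqP/ord_inj.
have {ib}ik1 : i != k.+1 :> nat by apply: contraNneq ib => ?; exact/eqP/ord_inj.
have lti := ltn_ord i.
have ltk' : (unbump i k < n)%N by rewrite /unbump; lia.
exists (Ordinal ltk'); rewrite negbK !ffunE; apply/eqP.
transitivity (x a); first by congr (x _); apply: val_inj; rewrite /= /bump /unbump; lia.
by rewrite xk; congr (x _); apply: val_inj; rewrite /= /bump /unbump; lia.
Qed.

Definition norm_chain n : zmodType := Quotient.quot (@degenerate_chain n).

Definition norm_bd n : {additive norm_chain n.+1 -> norm_chain n} :=
  qmap (@free_bd_degenerate n).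

Lemma norm_bdE n c :
  norm_bd n (\pi_(norm_chain n.+1) c) = \pi_(norm_chain n) (free_bd c).
Proof. exact: qmapE. Qed.

Lemma norm_bd_bd n (c : norm_chain n.+2) : norm_bd n (norm_bd n.+1 c) = 0.
Proof. by elim/quotW: c => c; rewrite !norm_bdE free_bd_bd raddf0. Qed.

Definition norm_complex : complex :=
  @Complex norm_chain norm_bd norm_bd_bd.

Definition norm_simplex n (x : nerve T n) : norm_complex n :=
  \pi_(norm_chain n) << x >>.

Lemma norm_simplex_eq0 n (x : nerve T n) :
  ~~ nondegenerate x -> norm_simplex x = 0.
Proof.
move=> /degenerateP xd; rewrite -(raddf0 \pi_(norm_chain n)); apply/eqP.
by rewrite -Quotient.idealrBE subr0; apply: mem_zspan; exists x.
Qed.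

End NormalisedComplex.

Record extmetric (R : realType) (T : Type) := ExtMetric {
  emdist :> T -> T -> \bar R;
  emdist_ge0 : forall x y, (0 <= emdist x y)%E;
  emdist_refl : forall x, emdist x x = 0%E;
  emdist_sym : forall x y, emdist x y = emdist y x;
  emdist_triangle : forall x y z,
    (emdist x z <= emdist x y + emdist y z)%E;
  emdist_sep : forall x y, emdist x y = 0%E -> x = y }.

Section LengthFiltration.
Context (R : realType) (T : choiceType) (d : extmetric R T).
Implicit Types (n : nat) (l : {nonneg R}).

Definition len n (x : nerve T n) : \bar R :=
  (\sum_(i < n) d (x (widen_ord (leqnSn n) i)) (x (fintype.lift ord0 i)))%E.

Lemma len_bump (X : nat -> T) i n :
  (\sum_(j < n) d (X (bump i j)) (X (bump i j.+1)) <=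
   \sum_(j < if (i <= n)%N then n.+1 else n) d (X j) (X j.+1))%E.
Proof.
elim: n => [|n IHn].
  by rewrite big_ord0; apply: sume_ge0 => j _; exact: emdist_ge0.
rewrite big_ord_recr /=; case: (leqP i n.+1) => [|lti]; last first.
  move: IHn; rewrite leqNgt ltnW//= => IHn; rewrite big_ord_recr /=.
  have -> : bump i n = n by rewrite /bump; lia.
  have -> : bump i n.+1 = n.+1 by rewrite /bump; lia.
  exact: leeD.
rewrite leq_eqVlt => /orP[/eqP iE|lti].
  move: IHn; rewrite iE ltnn => IHn; rewrite 2!big_ord_recr /= -addeA.
  have -> : bump n.+1 n = n by rewrite /bump; lia.
  have -> : bump n.+1 n.+1 = n.+2 by rewrite /bump; lia.
  by apply: leeD => //; exact: emdist_triangle.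
move: IHn; rewrite -ltnS lti => IHn; rewrite [leRHS]big_ord_recr /=.
have -> : bump i n = n.+1 by rewrite /bump; lia.
have -> : bump i n.+1 = n.+2 by rewrite /bump; lia.
exact: leeD.
Qed.

Lemma len_face n (i : 'I_n.+2) (x : nerve T n.+1) :
  (len (face i x) <= len x)%E.
Proof.
pose X j := x (inord j).
have -> : len (face i x) = (\sum_(j < n) d (X (bump i j)) (X (bump i j.+1)))%E.
  apply: eq_bigr => j _; rewrite !ffunE; have := ltn_ord j => ltj.
  by congr (d (x _) (x _)); apply: ord_inj; rewrite /= inordK // /bump /=; lia.
have -> : len x = (\sum_(j < n.+1) d (X j) (X j.+1))%E.
  apply: eq_bigr => j _; have := ltn_ord j => ltj.
  by congr (d (x _) (x _)); apply: ord_inj; rewrite /= inordK // /bump /=; lia.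
have [lein|ltni] := leqP i n; first by have := len_bump X i n; rewrite lein.
apply: (le_trans (len_bump X i n)).
by rewrite leqNgt ltni /= [leRHS]big_ord_recr /= leeDl // emdist_ge0.
Qed.

(* The chains do not depend on the metric, only the filtration does. *)
Definition filt l n : {pred norm_complex T n} :=
  zspan [set norm_simplex x |
         x in [set x : nerve T n | nondegenerate x /\ (len x <= l%:num%:E)%E]].

Arguments filt : clear implicits.

HB.instance Definition _ l n := GRing.ZmodClosed.on (filt l n).

Lemma filt_bd l n c :
  c \in filt l n.+1 -> bd (norm_complex T) n c \in filt l n.
Proof.
apply: zspan_ind => _ [x [_ xl]] <-.
rewrite [X in X \in _]norm_bdE free_bdU raddf_sum; apply: rpred_sum => i _.
apply: freeg_sign_mem; change (norm_simplex (face i x) \in filt l n).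
have [fx|/norm_simplex_eq0 ->] := boolP (nondegenerate (face i x)).
  apply: mem_zspan; exists (face i x) => //.
  by split=> //; apply: le_trans (len_face i x) xl.
exact: rpred0.
Qed.

Lemma filt_le l l' : l <= l' -> forall n c, c \in filt l n -> c \in filt l' n.
Proof.
move=> ll' n; apply: (@zspan_ind _ _ _ idfun) => _ [x [xnd xl]] <-.
apply: mem_zspan; exists x => //; split=> //.
by apply: le_trans xl _; rewrite lee_fin.
Qed.

Definition filt_complex l : complex := subcomplex (@filt_bd l).

Definition filt_incl l l' (h : l <= l') :
    chainmap (filt_complex l) (filt_complex l') :=
  subcomplex_incl (@filt_bd l) (@filt_bd l') (filt_le h).

End LengthFiltration.

Record pmod (R : realType) := PMod {
  pobj :> {nonneg R} -> zmodType;
  pmap : forall l l' : {nonneg R}, l <= l' -> {additive pobj l -> pobj l'};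
  pmap_id : forall (l : {nonneg R}) (h : l <= l) (v : pobj l), pmap h v = v;
  pmap_comp : forall (l l' l'' : {nonneg R})
    (h : l <= l') (h' : l' <= l'') (h'' : l <= l'') (v : pobj l), pmap h' (pmap h v) = pmap h'' v }.

Section Interleaving.
Context (R : realType).
Implicit Types (l e : {nonneg R}) (M N : pmod R).

Definition shift e l : {nonneg R} := (l%:num + e%:num)%:nng.

Lemma shift_le e l l' : l <= l' -> shift e l <= shift e l'.
Proof. by move=> ll'; rewrite -num_le /= lerD2r num_le. Qed.

Lemma shift2_ge e l : l <= shift e (shift e l).
Proof. by rewrite -num_le /= -addrA lerDl addr_ge0. Qed.

(* [shift e (shift e l)] is l + 2 e up to propositional equality only, so that
   the composites are compared in M ((l + e) + e) and N ((l + e) + e). *)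
Definition interleaved e M N : Prop :=
  exists (phi : forall l, {additive M l -> N (shift e l)})
         (psi : forall l, {additive N l -> M (shift e l)}),
  [/\ forall l l' (h : l <= l') (v : M l),
        phi l' (pmap M h v) = pmap N (shift_le e h) (phi l v),
      forall l l' (h : l <= l') (w : N l),
        psi l' (pmap N h w) = pmap M (shift_le e h) (psi l w),
      forall l (v : M l),
        psi (shift e l) (phi l v) = pmap M (shift2_ge e l) v &
      forall l (w : N l),
        phi (shift e l) (psi l w) = pmap N (shift2_ge e l) w].

Definition interleaving_dist M N : \bar R :=
  ereal_inf [set e%:num%:E | e in [set e | interleaved e M N]].

End Interleaving.

Section PersistentMagnitudeHomology.
Context (R : realType) (T : choiceType) (d : extmetric R T) (n : nat).
Implicit Types l : {nonneg R}.

Definition PH_map l l' (h : l <= l') :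
    {additive homology (filt_complex d l) n -> homology (filt_complex d l') n} :=
  homology_map (filt_incl d h) n.

Lemma PH_map_id l (h : l <= l) v : PH_map h v = v.
Proof.
rewrite -[v]reprK; set z := repr v; rewrite [LHS]homology_mapE; apply: congr1.
by apply: val_inj; apply: val_inj.
Qed.

Lemma PH_map_comp l l' l'' (h : l <= l') (h' : l' <= l'') (h'' : l <= l'') v :
  PH_map h' (PH_map h v) = PH_map h'' v.
Proof.
rewrite -[v]reprK; set z := repr v; rewrite /PH_map (homology_mapE _ z) !homology_mapE.
apply: (congr1 \pi_(homology (filt_complex d l'') n)).
by apply: val_inj; apply: val_inj.
Qed.

Definition PH : pmod R :=
  @PMod R (fun l => homology (filt_complex d l) n) PH_map PH_map_id PH_map_comp.

End PersistentMagnitudeHomology.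

(* Main.v *)
(** Adding [delta] to every distance lengthens an [n]-simplex by at most
    [n * delta], so in degrees at most [n.+1] the length filtrations of the two
    metrics include into each other after a shift by [n.+1 * delta].  Cycles of
    degree [n] and the chains of degree [n.+1] that bound them only live in
    these degrees, so the inclusions induce maps on [n]-th homology, although
    they are not defined on the whole filtered complexes. *)
Require Import Defs.
From HB Require Import structures.
From mathcomp Require Import all_boot all_order all_algebra.
From mathcomp Require Import all_classical all_reals ereal.

Set Implicit Arguments.
Unset Strict Implicit.
Unset Printing Implicit Defensive.

Import Order.TTheory GRing.Theory Num.Theory.

Local Open Scope quotient_scope.
Local Open Scope ring_scope.

Section InclusionInTwoDegrees.
Context (C : complex) (S S' : forall n, zmodClosed (C n)).
Context (bdS : forall n c, c \in S n.+1 -> bd C n c \in S n).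
Context (bdS' : forall n c, c \in S' n.+1 -> bd C n c \in S' n).
Context (n : nat) (SS'n : forall c, c \in S n -> c \in S' n).
Context (SS'n1 : forall c, c \in S n.+1 -> c \in S' n.+1).

(** Both differentials restrict that of [C], and vanishing is tested on underlying chains of [C].
    The case split only unfolds [cycle]. *)
Lemma sgmap_cycle c : c \in @Defs.cycle (subcomplex bdS) n ->
  sgmap (f := idfun) SS'n c \in @Defs.cycle (subcomplex bdS') n.
Proof. by move: SS'n c; case: n. Qed.

Definition sgmap_cyclemap :
    {additive subgrp (@Defs.cycle (subcomplex bdS) n) ->
              subgrp (@Defs.cycle (subcomplex bdS') n)} :=
  sgmap sgmap_cycle.

Lemma sgmap_boundary z : z \in @boundary (subcomplex bdS) n ->
  sgmap_cyclemap z \in @boundary (subcomplex bdS') n.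
Proof.
(* The bounding chain lives one degree up, hence the inclusion [SS'n1]. *)
move=> /asboolP[b zb]; apply/asboolP; exists (sgmap (f := idfun) SS'n1 b).
by apply: val_inj; exact: (congr1 val zb).
Qed.

Definition sgmap_homology :
    {additive homology (subcomplex bdS) n -> homology (subcomplex bdS') n} :=
  qmap sgmap_boundary.

Lemma sgmap_homologyE z :
  sgmap_homology (\pi_(homology (subcomplex bdS) n) z) =
  \pi_(homology (subcomplex bdS') n) (sgmap_cyclemap z).
Proof. exact: qmapE. Qed.

End InclusionInTwoDegrees.

Section ComparisonOfMetrics.
Context (R : realType) (T : choiceType) (delta : {nonneg R}).
Implicit Types (n k : nat) (e l : {nonneg R}).

Lemma len_le_perturb (d d' : extmetric R T)
    (dd' : forall x y, (d' x y <= d x y + delta%:num%:E)%E) k (x : nerve T k) :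
  (len d' x <= len d x + (k%:R * delta%:num)%:E)%E.
Proof.
have -> : ((k%:R * delta%:num)%:E = \sum_(i < k) delta%:num%:E :> \bar R)%E.
  by rewrite sumEFin sumr_const card_ord mulr_natl.
by rewrite -big_split /=; apply: lee_sum => i _; exact: dd'.
Qed.

(** The shift [e] is kept independent of the degree [k], so that a single [e] serves both degrees
    [n] and [n.+1]. *)
Lemma filt_perturb (d d' : extmetric R T)
    (dd' : forall x y, (d' x y <= d x y + delta%:num%:E)%E) k e
    (ke : k%:R * delta%:num <= e%:num) l c :
  c \in @filt R T d l k -> c \in @filt R T d' (shift e l) k.
Proof.
move: c; apply: (@zspan_ind _ _ _ idfun) => _ [x [xnd xl]] <-.
apply: mem_zspan; exists x => //; split=> //.
by apply: (le_trans (len_le_perturb dd' x)); rewrite EFinD leeD.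
Qed.

Context (n : nat) (e : {nonneg R}) (ne : n.+1%:R * delta%:num <= e%:num).

Let ne' : n%:R * delta%:num <= e%:num.
Proof. by apply: le_trans ne; rewrite ler_wpM2r// ler_nat. Qed.

Definition PH_perturb (d d' : extmetric R T)
    (dd' : forall x y, (d' x y <= d x y + delta%:num%:E)%E) l :
    {additive homology (filt_complex d l) n ->
              homology (filt_complex d' (shift e l)) n} :=
  sgmap_homology (@filt_bd R T d l) (@filt_bd R T d' (shift e l))
    (@filt_perturb _ _ dd' _ _ ne' l) (@filt_perturb _ _ dd' _ _ ne l).

Lemma PH_perturb_natural (d d' : extmetric R T)
    (dd' : forall x y, (d' x y <= d x y + delta%:num%:E)%E) l l'
    (h : l <= l') (v : homology (filt_complex d l) n) :
  PH_perturb dd' l' (PH_map d n h v) =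
  PH_map d' n (shift_le e h) (PH_perturb dd' l v).
Proof.
rewrite -[v]reprK; move: (repr v) => z.
rewrite /PH_perturb /PH_map (homology_mapE _ z) !sgmap_homologyE homology_mapE.
(* Both sides are classes of the same chain: one [val_inj] strips the cycle condition, the other the
   filtration bound. *)
by apply: congr1; do 2 apply: val_inj.
Qed.

(** Going to [d'] and back leaves the underlying chain unchanged, so the composite is induced by the
    inclusion of filtration levels for [d]. *)
Lemma PH_perturbK (d d' : extmetric R T)
    (dd' : forall x y, (d' x y <= d x y + delta%:num%:E)%E)
    (d'd : forall x y, (d x y <= d' x y + delta%:num%:E)%E) l
    (v : homology (filt_complex d l) n) :
  PH_perturb d'd (shift e l) (PH_perturb dd' l v) =
  PH_map d n (shift2_ge e l) v.
Proof.
rewrite -[v]reprK; move: (repr v) => z.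
rewrite /PH_perturb /PH_map (homology_mapE _ z).
rewrite (sgmap_homologyE _ _ _ z) sgmap_homologyE.
by apply: congr1; do 2 apply: val_inj.
Qed.

Lemma PH_interleaved (dX dY : extmetric R T)
    (hXY : forall x y, (dX x y <= dY x y + delta%:num%:E)%E)
    (hYX : forall x y, (dY x y <= dX x y + delta%:num%:E)%E) :
  interleaved e (PH dX n) (PH dY n).
Proof.
(* The map out of [PH dX n] needs lengths for [dY] bounded by those for [dX], which is [hYX]. *)
exists (PH_perturb hYX), (PH_perturb hXY); split.
- exact: PH_perturb_natural.
- exact: PH_perturb_natural.
- exact: PH_perturbK.
- exact: PH_perturbK.
Qed.

End ComparisonOfMetrics.

Theorem theorem6p4 (R : realType) (T : choiceType) (delta : {nonneg R})
    (dX dY : extmetric R T)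
    (hXY : forall x y : T, (dX x y <= dY x y + delta%:num%:E)%E)
    (hYX : forall x y : T, (dY x y <= dX x y + delta%:num%:E)%E) (n : nat) :
  interleaved (n.+1%:R * delta%:num)%:nng (PH dX n) (PH dY n) /\
  (interleaving_dist (PH dX n) (PH dY n) <= (n.+1%:R * delta%:num)%:E)%E.
Proof.
have XY : interleaved (n.+1%:R * delta%:num)%:nng (PH dX n) (PH dY n).
  (* The bound required of the shift holds here with equality. *)
  by apply: (@PH_interleaved _ _ delta).
by split=> //; apply: ereal_inf_lbound; exists (n.+1%:R * delta%:num)%:nng.
Qed.
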